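(* Let $N_r\ge 1$, let $\mathcal{S}$ be a nonempty finite index set (the selected users), and let $\mathbf{h}_i\in\mathbb{C}^{N_r}$, $i\in\mathcal{S}$, be vectors with $\|\mathbf{h}_i\|=1$ for all $i\in\mathcal{S}$. Let $P>0$ and let $\mathbf{m}^*\in\mathbb{C}^{N_r}$ be an optimal solution of $$\max_{\mathbf{m}\in\mathbb{C}^{N_r},\ \|\mathbf{m}\|=1}\ \min_{k\in\mathcal{S}} P\,|\mathbf{m}^{\mathsf{H}}\mathbf{h}_k|^2 .$$ For $i,j\in\mathcal{S}$ put $$\alpha_{i,j}=\arccos|\mathbf{h}_i^{\mathsf{H}}\mathbf{h}_j|\in[0,\tfrac{\pi}{2}],\qquad \theta_i=\arccos|\mathbf{m}^{*\mathsf{H}}\mathbf{h}_i|\in[0,\tfrac{\pi}{2}],\qquad \alpha=\max_{i,j\in\mathcal{S}}\alpha_{i,j}.$$ Then $\alpha\ge\theta_i\ge 0$ for all $i\in\mathcal{S}$.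
   Context: $(\cdot)^{\mathsf{H}}$ denotes conjugate transpose and $\|\cdot\|$ the Euclidean norm on $\mathbb{C}^{N_r}$. The vector $\mathbf{h}_i$ is the channel of user $i$, $\mathbf{m}$ is the receive beam steering vector, and $P$ is the maximum transmit power. *)

(* Defs.v *)
From mathcomp Require Import all_boot all_order all_algebra.
From mathcomp Require Import complex.
From mathcomp Require Import reals trigo.

Set Implicit Arguments.
Unset Strict Implicit.
Unset Printing Implicit Defensive.

Import Order.TTheory GRing.Theory Num.Theory.
Import ComplexField.

Local Open Scope ring_scope.
Local Open Scope sesquilinear_scope.

Definition herm (R : realType) (n : nat) (u v : 'cV[R[i]]_n) : R[i] :=
  (u ^t* *m v) 0 0.

(* The norm `|z| of MathComp is valued in R[i]; Normc.normc is the same modulus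
   as an element of R. *)
Definition enorm (R : realType) (n : nat) (u : 'cV[R[i]]_n) : R :=
  Num.sqrt (\sum_(k < n) Normc.normc (u k 0) ^+ 2).

Definition angle (R : realType) (n : nat) (u v : 'cV[R[i]]_n) : R :=
  acos (Normc.normc (herm u v)).

(* \big needs a starting value, and R has no least or greatest element: the
   value of F at some element of the nonempty type S serves as one, so that the
   iterated operation is the true minimum (maximum) of F over S. *)
Definition fin_min (R : realType) (S : finType) (hS : (0 < #|S|)%N)
    (F : S -> R) : R :=
  \big[Num.min/F (enum_val (Ordinal hS))]_(k : S) F k.

Definition fin_max (R : realType) (S : finType) (hS : (0 < #|S|)%N)
    (F : S -> R) : R :=
  \big[Num.max/F (enum_val (Ordinal hS))]_(k : S) F k.

Definition min_power (R : realType) (n : nat) (S : finType)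
    (hS : (0 < #|S|)%N) (h : S -> 'cV[R[i]]_n) (P : R) (m : 'cV[R[i]]_n) : R :=
  fin_min hS (fun k => P * Normc.normc (herm m (h k)) ^+ 2).

Definition is_optimal (R : realType) (n : nat) (S : finType)
    (hS : (0 < #|S|)%N) (h : S -> 'cV[R[i]]_n) (P : R) (m : 'cV[R[i]]_n) :
    Prop :=
  enorm m = 1 /\
  forall m' : 'cV[R[i]]_n, enorm m' = 1 ->
    min_power hS h P m' <= min_power hS h P m.

(* Main.v *)
Require Import Defs.
From mathcomp Require Import all_boot all_order all_algebra.
From mathcomp Require Import complex.
From mathcomp Require Import reals trigo.

Import Order.TTheory GRing.Theory Num.Theory.

Local Open Scope ring_scope.

(** Test the optimality of [m*] against [m = h_i]: if [k] attains the minimum of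
    [|h_i^H h_k|], then [|h_i^H h_k| <= |m*^H h_i|], that is,
    [theta_i <= alpha_(i,k) <= alpha]. *)

(** Each [h i] is itself a feasible beam, so its worst gain cannot exceed that of [mstar], which is
    at most the gain of [mstar] at user [i]. Passing from gains to angles uses that [acos] is
    decreasing ([le_acos]) on [-1, 1], where [herm_le1] places the moduli. *)

Lemma normc_ge0 (R : rcfType) (z : R[i]) : 0 <= Normc.normc z.
Proof. by case: z => a b; rewrite /= sqrtr_ge0. Qed.

Lemma normc_conj (R : rcfType) (z : R[i]) :
  Normc.normc (Num.conj z) = Normc.normc z.
Proof. by case: z => a b; rewrite /= sqrrN. Qed.

Lemma normc_sum (R : rcfType) (I : Type) (r : seq I) (F : I -> R[i]) :
  Normc.normc (\sum_(k <- r) F k) <= \sum_(k <- r) Normc.normc (F k).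
Proof.
elim/big_ind2: _ => [|x a y b xa yb|//]; first by rewrite Normc.normc0.
apply: le_trans (lerD xa yb); exact: le_normcD.
Qed.

(** Cauchy-Schwarz for unit vectors: sum 2|u_k||v_k| <= |u_k|^2 + |v_k|^2 over k; the right side
    totals 2. *)
Lemma herm_le1 (R : realType) (n : nat) (u v : 'cV[R[i]]_n) :
  enorm u = 1 -> enorm v = 1 -> Normc.normc (herm u v) <= 1.
Proof.
have enorm1 (w : 'cV[R[i]]_n) : enorm w = 1 ->
    \sum_(k < n) Normc.normc (w k 0) ^+ 2 = 1.
  move=> w1; have w0 : 0 <= \sum_(k < n) Normc.normc (w k 0) ^+ 2.
    by apply: sumr_ge0 => k _; rewrite sqr_ge0.
  by rewrite -(sqr_sqrtr w0) -[Num.sqrt _]/(enorm w) w1 expr1n.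
move=> /enorm1 u1 /enorm1 v1; rewrite /herm mxE.
apply: le_trans (normc_sum _ _ _ _) _.
rewrite -(ler_pMn2r (n := 2)) // -[X in _ <= X]/(1 + 1) -{1}u1 -v1.
rewrite -sumrMnl -big_split ler_sum //= => k _.
by rewrite !mxE Normc.normcM normc_conj -subr_ge0 addrAC -sqrrB sqr_ge0.
Qed.

(** Follows from the strict decrease of [cos] on [0, pi], the range of [acos]. *)
Lemma le_acos (R : realType) (x y : R) :
  -1 <= x <= 1 -> -1 <= y <= 1 -> x <= y -> acos y <= acos x.
Proof.
move=> xB yB xy; rewrite leNgt; apply/negP => lt_acos.
have [xI xK] := acos_def xB; have [yI yK] := acos_def yB.
by move: lt_acos; rewrite -ltr_cos ?in_itv //= xK yK ltNge xy.
Qed.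

Lemma fin_min_attained (R : realType) (S : finType) (hS : (0 < #|S|)%N)
    (F : S -> R) : exists k, fin_min hS F = F k.
Proof.
(* Being a value of [F] holds for the starting value and is preserved by [Num.min]. *)
rewrite /fin_min; elim/big_ind: _ => [|x y [i ->] [j ->]|k _].
- by eexists.
- by rewrite minEle; case: ifP; [exists i | exists j].
- by exists k.
Qed.

Theorem theorem5p1 (R : realType) (Nr : nat) (hNr : (1 <= Nr)%N)
    (S : finType) (hS : (0 < #|S|)%N) (h : S -> 'cV[R[i]]_Nr)
    (hnorm : forall i : S, enorm (h i) = 1)
    (P : R) (hP : 0 < P)
    (mstar : 'cV[R[i]]_Nr) (hopt : is_optimal hS h P mstar) :
  let alpha_ (i j : S) : R := angle (h i) (h j) in
  let theta (i : S) : R := angle mstar (h i) in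
  let alpha : R := fin_max hS (fun i => fin_max hS (fun j => alpha_ i j)) in
  forall i : S, alpha >= theta i /\ theta i >= 0.
Proof.
move=> alpha_ theta alpha i; have [m1 mopt] := hopt.
have hermB (u v : 'cV[R[i]]_Nr) : enorm u = 1 -> enorm v = 1 ->
    -1 <= Normc.normc (herm u v) <= 1.
  move=> u1 v1; rewrite herm_le1 // andbT.
  exact: le_trans (lerN10 _) (normc_ge0 _ _).
split; last by apply/acos_ge0/hermB.
have [k kmin] := fin_min_attained R S hS
  (fun k => P * Normc.normc (herm (h i) (h k)) ^+ 2).
have le_ik : Normc.normc (herm (h i) (h k)) <= Normc.normc (herm mstar (h i)).
  (* After squaring and scaling by [P], the left side is the objective at [h i], and the right side
     is one of the terms minimized at [mstar]. *)
  rewrite -ler_sqr ?nnegrE ?normc_ge0 // -(ler_pM2l hP) -kmin.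
  exact: le_trans (mopt _ (hnorm i)) (bigmin_le _ _ _).
apply: (@le_trans _ _ (alpha_ i k)); first by apply: le_acos; rewrite ?hermB.
by apply: (bigmax_sup i) => //; apply: le_bigmax.
Qed.
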